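(* Consider an instance of the PP-problem with job set $N$, processing times $a_j,b_j$ and storage capacity $\Omega$, and let $a_{max}=\max_{i\in N}a_i$, $b_{max}=\max_{i\in N}b_i$. If $$3.5\,a_{max}+\max\{0.5\,a_{max},\,b_{max}\}\le \Omega,$$ then Algorithm 1 (given in the context, producing a schedule $\sigma$ for the extended job set $N'=N\cup X\cup Y$) constructs an optimal schedule, i.e. $\sigma$ is a feasible schedule for the job set $N'$ with storage capacity $\Omega$, and its makespan is minimum among all such feasible schedules.
   Context: PP-problem. An instance consists of a set of jobs $N=\{1,\dots,n\}$, nonnegative processing times $a_j$ and $b_j$ for each $j\in N$, and a storage capacity $\Omega$. Each job $j$ must be processed without interruption on the first-stage machine $M_1$ for $a_j$ time units and, after that, without interruption on the second-stage machine $M_2$ for $b_j$ time units. A schedule $\sigma$ specifies start times $S_j^1(\sigma)\ge 0$ and $S_j^2(\sigma)\ge 0$ on $M_1$ and $M_2$; the completion times are $C_j^1(\sigma)=S_j^1(\sigma)+a_j$ and $C_j^2(\sigma)=S_j^2(\sigma)+b_j$. The schedule is feasible if: (i) each machine processes at most one job at a time (for distinct jobs $i,j$ and each machine $M_k$, either $C_i^k(\sigma)\le S_j^k(\sigma)$ or $C_j^k(\sigma)\le S_i^k(\sigma)$); (ii) $S_j^2(\sigma)\ge C_j^1(\sigma)$ for every job $j$; (iii) each job $j$ occupies $a_j$ units of storage from $S_j^1(\sigma)$ until $C_j^2(\sigma)$, and at any time $t$ the total storage occupied, $\sum_{j:\,S_j^1(\sigma)\le t<C_j^2(\sigma)}a_j$,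 does not exceed $\Omega$. The goal is to find a feasible schedule minimising the makespan $C_{\max}(\sigma)=\max_j C_j^2(\sigma)$. The same definitions apply to any other finite job set, such as $N'$ below. Johnson's rule. Let $L_1=\{i\in N: a_i<b_i\}$ and $L_2=\{i\in N: a_i\ge b_i\}$. Johnson's order lists first the jobs of $L_1$ in nondecreasing order of $a_i$, then the jobs of $L_2$ in nonincreasing order of $b_i$ (ties broken arbitrarily). Number the jobs $1,\dots,n$ in this order. Let $\sigma^J$ be the schedule, ignoring the storage constraint, in which both machines process the jobs in this order as early as possible; $C_{\max}(\sigma^J)=\max_{k}\bigl(\sum_{i=1}^k a_i+\sum_{i=k}^n b_i\bigr)$. Extended job set. Let $a_{max}=\max_{i\in N}a_i>0$, $b_{max}=\max_{i\in N}b_i>0$, $Idle_1=C_{\max}(\sigma^J)-\sum_{i\in N}a_i$, $Idle_2=C_{\max}(\sigma^J)-\sum_{i\in N}b_i$. Let $X$, $Y$ be disjoint sets of auxiliary jobs (disjoint from $N$) with $|X|=\lceil Idle_2/b_{max}\rceil$, $|Y|=\lceil Idle_1/a_{max}\rceil$; for $i\in X$, $a_i=0$ and $b_i=Idle_2/|X|$; for $i\in Y$, $a_i=Idle_1/|Y|$ and $b_i=0$. Let $N'=N\cup X\cup Y$ and $n'=n+|X|+|Y|$. Let $\pi^J$ be the permutation of $N'$ listing first the jobs of $X$ (arbitrary order), then the jobs of $N$ in Johnson's order, then the jobs of $Y$ (arbitrary order). Let $$L_0'=X\cup\{i\in L_1: a_i\le \tfrac12 a_{max}\},\quad L_1'=\{i\in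 L_1: a_i>\tfrac12 a_{max}\},\quad L_2'=L_2\cup Y,$$ and let $\pi_0,\pi_1,\pi_2$ be the permutations of $L_0',L_1',L_2'$, respectively, induced by $\pi^J$; $\pi_r(j)$ is the $j$-th job in $\pi_r$. Notation. $\Delta_j=b_j-a_j$ for $j\in N'$; $\mu(k)=\sum_{j=k}^{|L_0'|}\Delta_{\pi_0(j)}$ for $1\le k\le |L_0'|$; for a (partially built) sequence $\pi$, $l_{k,1}(\pi)=\sum_{j=1}^k a_{\pi(j)}$, $l_{k,2}(\pi)=\sum_{j=1}^k b_{\pi(j)}$, $R_k(\pi)=l_{k,2}(\pi)-l_{k,1}(\pi)$, with $l_{0,1}=l_{0,2}=R_0=0$. Algorithm 1. Start with $i=i_0=i_1=i_2=1$ and $\pi$ empty. First loop: while $i_0\le |L_0'|$ do: if [$R_{i-1}(\pi)<2a_{max}$ and $R_{i-1}(\pi)+\Delta_{\pi_2(i_2)}+\mu(i_0)<a_{max}$] or [$R_{i-1}(\pi)<\tfrac32 a_{max}$], set $\pi(i)=\pi_0(i_0)$ and $i_0:=i_0+1$; otherwise set $\pi(i)=\pi_2(i_2)$ and $i_2:=i_2+1$. (The test is regarded as true whenever $R_{i-1}(\pi)<\tfrac32a_{max}$, irrespective of the other condition.) Then set $S^1_{\pi(i)}(\sigma)=l_{i-1,1}(\pi)$, $S^2_{\pi(i)}(\sigma)=l_{i-1,2}(\pi)$ and $i:=i+1$. Second loop: while $i\le n'$ do: if $R_{i-1}(\pi)<2a_{max}$ and $i_1\le |L_1'|$, set $\pi(i)=\pi_1(i_1)$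 and $i_1:=i_1+1$; otherwise set $\pi(i)=\pi_2(i_2)$ and $i_2:=i_2+1$. Then set $S^1_{\pi(i)}(\sigma)=l_{i-1,1}(\pi)$, $S^2_{\pi(i)}(\sigma)=l_{i-1,2}(\pi)$ and $i:=i+1$. Return the schedule $\sigma$. *)

(* Defs.v *)
From mathcomp Require Import all_boot all_order all_algebra.

Set Implicit Arguments.
Unset Strict Implicit.
Unset Printing Implicit Defensive.

Import Order.TTheory GRing.Theory Num.Theory.
Local Open Scope ring_scope.

Record schedule (R : Type) (J : Type) := Schedule {
  start1 : J -> R;
  start2 : J -> R
}.

Section PPProblem.
Variables (R : realFieldType) (J : finType) (a b : J -> R) (Omega : R).
Implicit Types sigma : schedule R J.

Definition completion1 sigma (j : J) : R := start1 sigma j + a j.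
Definition completion2 sigma (j : J) : R := start2 sigma j + b j.

Definition storage sigma (t : R) : R :=
  \sum_(j | start1 sigma j <= t < completion2 sigma j) a j.

Definition feasible sigma : Prop :=
  [/\ forall j, 0 <= start1 sigma j /\ 0 <= start2 sigma j,
      forall i j, i != j ->
        (completion1 sigma i <= start1 sigma j \/
         completion1 sigma j <= start1 sigma i) /\
        (completion2 sigma i <= start2 sigma j \/
         completion2 sigma j <= start2 sigma i),
      forall j, completion1 sigma j <= start2 sigma j
    & forall t, storage sigma t <= Omega].

(* The default 0 is harmless: start and processing times are nonnegative. *)
Definition makespan sigma : R := \big[Num.max/0]_j completion2 sigma j.

Definition optimal sigma : Prop :=
  feasible sigma /\ forall tau, feasible tau -> makespan sigma <= makespan tau.

Definition schedule0 : schedule R J := Schedule (fun=> 0) (fun=> 0).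

Definition set_start sigma (j : J) (t1 t2 : R) : schedule R J :=
  Schedule [eta start1 sigma with j |-> t1] [eta start2 sigma with j |-> t2].

(* As early as possible in the order s on both machines, ignoring storage;
   t1 and t2 are the times from which M_1 and M_2 are free. *)
Fixpoint earliest_from (t1 t2 : R) (s : seq J) sigma : schedule R J :=
  if s is j :: s' then
    let u2 := Num.max (t1 + a j) t2 in
    earliest_from (t1 + a j) (u2 + b j) s' (set_start sigma j t1 u2)
  else sigma.

Definition earliest_schedule (s : seq J) : schedule R J :=
  earliest_from 0 0 s schedule0.

(* Ties may be broken arbitrarily, so this is a property of the ordering s. *)
Definition johnson_order (s : seq J) : Prop :=
  exists s1 s2 : seq J,
    [/\ s = s1 ++ s2,
        perm_eq s1 (enum [pred i | a i < b i]),
        perm_eq s2 (enum [pred i | b i <= a i]),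
        sorted (fun i j => a i <= a j) s1
      & sorted (fun i j => b j <= b i) s2].

End PPProblem.

(* Only meant for nonnegative p, for which the default 0 is harmless. *)
Definition max_time (R : realFieldType) (J : finType) (p : J -> R) : R :=
  \big[Num.max/0]_j p j.

Section ExtendedJobs.
Variables (R : archiRealFieldType) (N : finType) (a b : N -> R).
Variable sJ : seq N.

Definition Cmax_johnson : R := makespan b (earliest_schedule a b sJ).
Definition idle1 : R := Cmax_johnson - \sum_i a i.
Definition idle2 : R := Cmax_johnson - \sum_i b i.

(* Both idle times are nonnegative, so taking absolute values merely casts the
   integer ceilings to nat. *)
Definition cardX : nat := `|Num.ceil (idle2 / max_time b)|%N.
Definition cardY : nat := `|Num.ceil (idle1 / max_time a)|%N.

Definition ext_job : finType := ('I_cardX + N + 'I_cardY)%type.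
Definition jobX (i : 'I_cardX) : ext_job := inl (inl i).
Definition jobN (i : N) : ext_job := inl (inr i).
Definition jobY (i : 'I_cardY) : ext_job := inr i.

Definition ext_a (j : ext_job) : R :=
  match j with
  | inl (inl _) => 0
  | inl (inr i) => a i
  | inr _ => idle1 / cardY%:R
  end.

Definition ext_b (j : ext_job) : R :=
  match j with
  | inl (inl _) => idle2 / cardX%:R
  | inl (inr i) => b i
  | inr _ => 0
  end.

Definition ext_order (piJ : seq ext_job) : Prop :=
  exists xs ys, [/\ perm_eq xs (enum 'I_cardX), perm_eq ys (enum 'I_cardY)
    & piJ = map jobX xs ++ map jobN sJ ++ map jobY ys].

Definition inL0 (j : ext_job) : bool :=
  match j with
  | inl (inl _) => true
  | inl (inr i) => (a i < b i) && (a i <= max_time a / 2)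
  | inr _ => false
  end.

Definition inL1 (j : ext_job) : bool :=
  if j is inl (inr i) then (a i < b i) && (max_time a / 2 < a i) else false.

Definition inL2 (j : ext_job) : bool :=
  match j with
  | inl (inl _) => false
  | inl (inr i) => b i <= a i
  | inr _ => true
  end.

End ExtendedJobs.

(* [while fuel c f x] runs "while c do f".  The result is [None] if some
   execution of the body fails or if the loop has not stopped after [fuel]
   iterations. *)
Fixpoint while (T : Type) (fuel : nat) (c : T -> bool) (f : T -> option T)
    (x : T) : option T :=
  if c x then
    if fuel is fuel'.+1 then obind (while fuel' c f) (f x) else None
  else Some x.

Section Algorithm.
Variables (R : realFieldType) (J : finType) (a b : J -> R) (amax : R).
Variables pi0 pi1 pi2 : seq J.

(* The counters start at 0: [idx r] is the number of jobs already taken from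
   pi_r.  The position counter i is [(size (built st)).+1]. *)
Record state := State {
  built : seq J;
  idx0 : nat;
  idx1 : nat;
  idx2 : nat;
  sched : schedule R J
}.

Definition Delta (j : J) : R := b j - a j.
Definition mu (k : nat) : R := \sum_(j <- drop k pi0) Delta j.
Definition len (p : J -> R) (s : seq J) : R := \sum_(j <- s) p j.
Definition surplus (s : seq J) : R := len b s - len a s.

Definition place (st : state) (j : J) : schedule R J :=
  set_start (sched st) j (len a (built st)) (len b (built st)).

(* Taking a job from an exhausted list is a failure. *)
Definition take0 (st : state) : option state :=
  omap (fun j => State (rcons (built st) j)
                   (idx0 st).+1 (idx1 st) (idx2 st) (place st j))
       (onth pi0 (idx0 st)).
Definition take1 (st : state) : option state :=
  omap (fun j => State (rcons (built st) j)
                   (idx0 st) (idx1 st).+1 (idx2 st) (place st j))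
       (onth pi1 (idx1 st)).
Definition take2 (st : state) : option state :=
  omap (fun j => State (rcons (built st) j)
                   (idx0 st) (idx1 st) (idx2 st).+1 (place st j))
       (onth pi2 (idx2 st)).

(* The second alternative of the test is evaluated first, so that the next job
   of pi_2 need not exist when it holds. *)
Definition body1 (st : state) : option state :=
  let r := surplus (built st) in
  if r < 3 / 2 * amax then take0 st
  else obind (fun j =>
    if (r < 2 * amax) && (r + Delta j + mu (idx0 st) < amax)
    then take0 st else take2 st) (onth pi2 (idx2 st)).

Definition body2 (st : state) : option state :=
  if (surplus (built st) < 2 * amax) && (idx1 st < size pi1)%N
  then take1 st else take2 st.

(* Each iteration places one job, hence the fuel.  The start times in the
   initial state are placeholders. *)
Definition run : option (schedule R J) :=
  let st := State [::] 0 0 0 (schedule0 R J) in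
  let loop1 := while #|J| (fun st => idx0 st < size pi0)%N body1 in
  let loop2 := while #|J| (fun st => size (built st) < #|J|)%N body2 in
  omap sched (obind loop2 (loop1 st)).

End Algorithm.

Definition algorithm1 (R : archiRealFieldType) (N : finType) (a b : N -> R)
    (sJ : seq N) (piJ : seq (ext_job a b sJ)) :
    option (schedule R (ext_job a b sJ)) :=
  run (@ext_a R N a b sJ) (@ext_b R N a b sJ) (max_time a)
      [seq j <- piJ | inL0 j] [seq j <- piJ | inL1 j] [seq j <- piJ | inL2 j].

(* Main.v *)
(* On N' both machines carry the same total load C, so a schedule in which M_2
   never idles attains the lower bound C on the makespan; the algorithm starts
   the jobs without idle time on both machines, hence only feasibility is at
   stake.  Write R for the surplus before the job j being placed.

   Job j may start on M_2 iff a_j <= R.  This holds throughout Johnson's order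
   pi^J = pi_0 pi_1 pi_2, because X fills the initial idle time of M_2.  It is
   preserved by the algorithm: the first loop takes a job of L_2' only when
   R >= 3/2 amax, so that afterwards R >= amax/2, which suffices for L_0', and
   R + mu >= amax, so that R >= amax once L_0' is exhausted, which suffices for
   L_1'; when L_1' is exhausted too, the remaining jobs form a suffix of pi^J,
   with the same surplus.

   Let p be the first job whose completion on M_2 is after t.  The jobs from p on
   that have started by t occupy at most amax + R + b_p, where R is the surplus
   before p.  With beta = max (amax/2) bmax the invariant R <= 3/2 amax + beta
   gives R + b_p <= 5/2 amax + beta. *)
Require Import Defs.
From mathcomp Require Import all_boot all_order all_algebra.
From mathcomp Require Import lra zify.

Set Implicit Arguments.
Unset Strict Implicit.
Unset Printing Implicit Defensive.

Import Order.TTheory GRing.Theory Num.Theory.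
Local Open Scope ring_scope.

(** * Loops and splittings of sequences *)

Lemma while_ind_measure (T : Type) (P : T -> Prop) (m : T -> nat)
    (c : T -> bool) (f : T -> option T) :
  (forall x, P x -> c x -> exists y, [/\ f x = Some y, P y & (m y < m x)%N]) ->
  forall fuel x, P x -> (m x <= fuel)%N ->
  exists y, [/\ while fuel c f x = Some y, P y & ~~ c y].
Proof.
move=> step; elim=> [|k IH] x Px mx /=; case: ifPn => cx; try by exists x.
  (* Without fuel the measure is 0, so the condition cannot hold: an iteration would decrease the
     measure. *)
  by have [y [_ _]] := step _ Px cx; rewrite ltnNge (leq_trans mx).
have [y [-> Py myx]] := step _ Px cx.
by apply: IH => //; rewrite -ltnS (leq_trans myx).
Qed.

(** Sortedness makes the elements below a threshold a prefix; this separates the small from the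
    large jobs of [L_1]. *)
Lemma sorted_filter_cat (T : eqType) (R : numDomainType) (w : T -> R) (c : R)
    (s : seq T) :
  sorted (fun i j => w i <= w j) s ->
  [seq i <- s | w i <= c] ++ [seq i <- s | ~~ (w i <= c)] = s.
Proof.
have tr : transitive (fun i j : T => w i <= w j).
  by move=> y x z; apply: le_trans.
elim: s => //= x s IH; rewrite path_sortedE // => /andP[/allP xs /IH {}IH].
case: ifPn => [_ | wx] /=; first by rewrite IH.
rewrite (@eq_in_filter _ _ pred0) => [|y /xs xy]; last first.
  by apply: contraNF wx; apply: le_trans.
rewrite filter_pred0 /= (@eq_in_filter _ _ predT) ?filter_predT // => y /xs xy.
by apply: contraNN wx; apply: le_trans.
Qed.

Lemma cat_rcons_split (T : Type) (s : seq T) (x : T) (s1 s2 : seq T) (y : T) :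
  rcons s x = s1 ++ y :: s2 ->
  s1 = s /\ y = x \/ exists s2', s = s1 ++ y :: s2'.
Proof.
elim/last_ind: s2 => [|s2 z _]; rewrite -?rcons_cons -?rcons_cat.
  by rewrite cats1 => /rcons_inj[-> ->]; left.
by move=> /rcons_inj[-> _]; right; exists s2.
Qed.

Lemma has_split (T : Type) (p : pred T) (s : seq T) : has p s ->
  exists s1 x s2, [/\ s = s1 ++ x :: s2, p x & ~~ has p s1].
Proof.
elim: s => //= x s IH; have [px _|px /= /IH] := boolP (p x).
  by exists [::], x, s.
case=> [s1 [y [s2 [-> py s1p]]]]; exists (x :: s1), y, s2.
by rewrite /= (negbTE px).
Qed.

Lemma cat_eq_split (T : Type) (s t s1 s2 : seq T) (x : T) :
  s ++ t = s1 ++ x :: s2 ->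
  (exists r, s = s1 ++ x :: r) \/ exists2 r, s1 = s ++ r & t = r ++ x :: s2.
Proof.
elim: s s1 => [|y s IH] [|z s1] //=; try by right; eexists.
  by case=> -> _; left; exists s.
case=> -> /IH[[r ->]|[r -> ->]]; first by left; exists r.
by right; exists r.
Qed.

Lemma map_eq_split (T1 T2 : Type) (f : T1 -> T2) s s1 x s2 :
  map f s = s1 ++ x :: s2 ->
  exists t1 y t2, [/\ s = t1 ++ y :: t2, s1 = map f t1, x = f y & s2 = map f t2].
Proof.
elim: s s1 => [|y s IH] [|z s1] //= [].
  by move=> <- <-; exists [::], y, s.
move=> <- /IH[t1 [w [t2 [-> -> -> ->]]]].
by exists (y :: t1), w, t2.
Qed.

Lemma drop_onth (T : Type) (s : seq T) i x :
  onth s i = Some x -> drop i s = x :: drop i.+1 s.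
Proof.
by elim: s i => [|y s IH] [|i] //= => [[->]|/IH //]; rewrite drop0.
Qed.

Lemma take_onth (T : Type) (s : seq T) i x :
  onth s i = Some x -> take i.+1 s = rcons (take i s) x.
Proof.
by elim: s i => [|y s IH] [|i] //= => [[->]|/IH -> //]; rewrite take0.
Qed.

Lemma ex_onth (T : Type) (s : seq T) i :
  (i < size s)%N -> exists x, onth s i = Some x.
Proof. by rewrite -onthTE; case: onth => // x _; exists x. Qed.

(** * Sums and surpluses along sequences *)

Section Len.
Variables (R : realFieldType) (J : finType) (a b : J -> R).
Implicit Types (s : seq J) (j : J).

Lemma len_nil (p : J -> R) : len p [::] = 0.
Proof. exact: big_nil. Qed.

Lemma len_cons (p : J -> R) j s : len p (j :: s) = p j + len p s.
Proof. exact: big_cons. Qed.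

Lemma len_cat (p : J -> R) s1 s2 : len p (s1 ++ s2) = len p s1 + len p s2.
Proof. exact: big_cat. Qed.

Lemma len_rcons (p : J -> R) s j : len p (rcons s j) = len p s + p j.
Proof. by rewrite -cats1 len_cat len_cons len_nil addr0. Qed.

Lemma perm_len (p : J -> R) s1 s2 : perm_eq s1 s2 -> len p s1 = len p s2.
Proof. exact: perm_big. Qed.

Lemma len_ge0 (p : J -> R) s : (forall j, 0 <= p j) -> 0 <= len p s.
Proof. by move=> p0; apply: sumr_ge0. Qed.

Lemma le_len (p q : J -> R) s :
  (forall j, j \in s -> p j <= q j) -> len p s <= len q s.
Proof.
by move=> pq; rewrite /len big_seq [leRHS]big_seq; apply: ler_sum.
Qed.

Lemma surplus_cat s1 s2 : surplus a b (s1 ++ s2) = surplus a b s1 + surplus a b s2.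
Proof. rewrite /surplus !len_cat; lra. Qed.

Lemma surplus_rcons s j : surplus a b (rcons s j) = surplus a b s + (b j - a j).
Proof. rewrite /surplus !len_rcons; lra. Qed.

Lemma perm_surplus s1 s2 : perm_eq s1 s2 -> surplus a b s1 = surplus a b s2.
Proof. by move=> e; rewrite /surplus !(perm_len _ e). Qed.

Lemma surplus_ge0 s : (forall j, j \in s -> a j <= b j) -> 0 <= surplus a b s.
Proof. by move=> ab; rewrite subr_ge0 le_len. Qed.

Lemma mu_surplus s k : mu a b s k = surplus a b (drop k s).
Proof. by rewrite /mu /surplus /len -sumrB. Qed.

End Len.

(** * Load of [M_2] as a lower bound, and schedules without idle time *)

Section Schedules.
Variables (R : realFieldType) (J : finType) (a b : J -> R) (Omega : R).
Hypotheses (a_ge0 : forall j, 0 <= a j) (b_ge0 : forall j, 0 <= b j).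
Implicit Types (sigma tau : schedule R J) (s : seq J).

(** Induction on a set of jobs that complete by [T]: when one of them starts last on [M_2], the
    others complete by its start. Only jobs of positive length are compared, since a job of length 0
    may share its start time with another. *)
Lemma sum_le_makespan tau : feasible a b Omega tau ->
  \sum_j b j <= makespan b tau.
Proof.
case=> start_ge0 disj _ _.
suff le_bound (A : {set J}) T : 0 <= T ->
    (forall j, j \in A -> 0 < b j -> completion2 b tau j <= T) ->
    \sum_(j in A) b j <= T.
  have := le_bound [set: J] (makespan b tau).
  rewrite (eq_bigl predT) => [|j]; last by rewrite inE.
  apply => [|j _ _]; last exact: le_bigmax.
  exact: bigmax_ge_id.
have [k] := ubnP #|A|; elim: k A T => // k IH A T Ak T0 AT.
have [[j0 /andP[j0A bj0]]|no_pos] :=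
    altP (@existsP _ (fun j => (j \in A) && (0 < b j))).
  pose j := [arg max_(i > j0 | (i \in A) && (0 < b i)) start2 tau i]%O.
  have [jA bj jmax] : [/\ j \in A, 0 < b j &
      forall i, i \in A -> 0 < b i -> start2 tau i <= start2 tau j].
    rewrite /j; case: arg_maxP => [|i /andP[iA bi] imax].
      by rewrite j0A.
    by split=> // l lA bl; apply: imax; rewrite lA.
  rewrite (big_setD1 j) //=.
  have : \sum_(i in A :\ j) b i <= start2 tau j.
    apply: IH => [||i].
    - by rewrite (cardsD1 j A) jA in Ak.
    - by case: (start_ge0 j).
    rewrite !inE => /andP[ij iA] bi.
    case: (disj _ _ ij) => _ [//|]; have := jmax _ iA bi.
    rewrite /completion2; lra.
  have := AT _ jA bj; rewrite /completion2; lra.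
rewrite big1 // => j jA; apply/eqP; rewrite eq_le b_ge0 andbT leNgt.
by apply: contraNN no_pos => bj; apply/existsP; exists j; rewrite jA.
Qed.

Definition sequential s sigma := forall s1 j s2, s = s1 ++ j :: s2 ->
  start1 sigma j = len a s1 /\ start2 sigma j = len b s1.

(** The started jobs form a prefix of [s2]. All but the last of them have left [M_1] by [t], hence
    sum to at most [t - len a s1]; the last one adds at most [amax]. *)
Lemma started_len (amax : R) s sigma :
  0 <= amax -> (forall j, a j <= amax) -> sequential s sigma ->
  forall t s2 s1, s = s1 ++ s2 ->
  \sum_(j <- s2 | start1 sigma j <= t) a j <=
    if len a s1 <= t then t - len a s1 + amax else 0.
Proof.
move=> amax_ge0 le_amax seqs t; elim=> [|j s2 IH] s1 es.
  by rewrite big_nil; case: ifP => // le_t; lra.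
have [st1 _] := seqs _ _ _ es.
have := IH (rcons s1 j); rewrite es cat_rcons len_rcons => /(_ erefl).
rewrite big_cons st1; have := a_ge0 j; have := le_amax j.
case: ifP => le_t; case: ifP => le_t'; lra.
Qed.

Lemma sequential_storage (amax : R) s sigma t :
  0 <= amax -> (forall j, a j <= amax) ->
  perm_eq s (enum J) -> sequential s sigma ->
  (forall s1 j s2, s = s1 ++ j :: s2 -> a j <= surplus a b s1) ->
  0 <= Omega ->
  (forall s1 j s2, s = s1 ++ j :: s2 ->
    surplus a b s1 + b j + amax <= Omega) ->
  storage a b sigma t <= Omega.
Proof.
move=> amax_ge0 le_amax perm_s seqs prec Omega_ge0 bound.
have -> : storage a b sigma t =
    \sum_(j <- s | start1 sigma j <= t < completion2 b sigma j) a j.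
  by rewrite (perm_big _ perm_s) big_enum_cond.
have [some_late|no_late] :=
    boolP (has (fun j => t < completion2 b sigma j) s); last first.
  rewrite big1_seq // => j /andP[/andP[_ late] js].
  by case/hasP: no_late; exists j.
have [s1 [j [s2 [es late early]]]] := has_split some_late.
rewrite es big_cat /= big1_seq ?add0r => [|i /andP[/andP[_ i_late] is1]]; last first.
  by case/hasP: early; exists i.
have := started_len amax_ge0 le_amax seqs t es.
have := bound _ _ _ es; have := prec _ _ _ es; have := a_ge0 j; have := b_ge0 j.
have := late; rewrite /completion2; have [_ ->] := seqs _ _ _ es.
rewrite /surplus => late' bj aj prec_j bound_j started.
(* From [j] on, every started job is counted as stored. As [t < len b s1 + b j], the bound
   [t - len a s1 + amax] lies below [surplus a b s1 + b j + amax]. *)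
apply: (@le_trans _ _ (\sum_(i <- j :: s2 | start1 sigma i <= t) a i)).
  rewrite big_mkcond [X in _ <= X]big_mkcond; apply: ler_sum => i _ /=.
  by case: (start1 sigma i <= t) => //=; case: ifP.
by apply: le_trans started _; case: ifP => *; lra.
Qed.

Lemma len_prefix_disjoint (p : J -> R) s x y sx sy tx ty :
  (forall j, 0 <= p j) -> s = sx ++ x :: tx -> s = sy ++ y :: ty -> x != y ->
  len p sx + p x <= len p sy \/ len p sy + p y <= len p sx.
Proof.
move=> p0; elim: s sx sy => [|z s IH] [|u sx] [|v sy] //=.
- by move=> [-> _] [-> _]; rewrite eqxx.
- move=> [-> _] [-> _] _; left; rewrite len_nil len_cons.
  have := len_ge0 sy p0; lra.
- move=> [-> _] [-> _] _; right; rewrite len_nil len_cons.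
  have := len_ge0 sx p0; lra.
- move=> [-> ex] [-> ey] xy; rewrite !len_cons.
  by case: (IH _ _ ex ey xy) => ?; [left|right]; lra.
Qed.

(** Every job completes on [M_2] at a prefix sum of [b], hence by the total load of [M_2], which no
    makespan can beat. *)
Lemma sequential_optimal (amax : R) s sigma :
  0 <= amax -> (forall j, a j <= amax) ->
  perm_eq s (enum J) -> sequential s sigma ->
  (forall s1 j s2, s = s1 ++ j :: s2 -> a j <= surplus a b s1) ->
  0 <= Omega ->
  (forall s1 j s2, s = s1 ++ j :: s2 ->
    surplus a b s1 + b j + amax <= Omega) ->
  optimal a b Omega sigma.
Proof.
move=> amax_ge0 le_amax perm_s seqs prec Omega_ge0 bound.
have split_at j : exists s1 s2, s = s1 ++ j :: s2.
  have : j \in s by rewrite (perm_mem perm_s) mem_enum.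
  by case/splitPr => s1 s2; exists s1, s2.
split; last first.
  move=> tau /sum_le_makespan; apply: le_trans; apply: bigmax_le => [|j _].
    exact: sumr_ge0.
  have [s1 [s2 es]] := split_at j.
  rewrite -big_enum /= -[X in _ <= X](perm_len _ perm_s) es.
  rewrite /completion2; have [_ ->] := seqs _ _ _ es.
  rewrite len_cat len_cons; have := len_ge0 s2 b_ge0; lra.
split.
- move=> j; have [s1 [s2 es]] := split_at j; have [-> ->] := seqs _ _ _ es.
  by rewrite !len_ge0.
- move=> i j ij; have [s1 [s2 es]] := split_at i; have [s3 [s4 es']] := split_at j.
  rewrite /completion1 /completion2.
  have [-> ->] := seqs _ _ _ es; have [-> ->] := seqs _ _ _ es'.
  by split; apply: len_prefix_disjoint; eauto.
- move=> j; have [s1 [s2 es]] := split_at j.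
  rewrite /completion1; have [-> ->] := seqs _ _ _ es.
  have := prec _ _ _ es; rewrite /surplus; lra.
- by move=> t; exact: (sequential_storage t amax_ge0 le_amax perm_s seqs prec).
Qed.

(** * Lower bounds on the earliest schedule *)

Lemma earliest_from_notin s t1 t2 sigma j : j \notin s ->
  start2 (earliest_from a b t1 t2 s sigma) j = start2 sigma j.
Proof.
elim: s t1 t2 sigma => //= i s IH t1 t2 sigma; rewrite inE negb_or.
by case/andP => ji js; rewrite IH //= (negbTE ji).
Qed.

(** By [uniq], a start time once set is not overwritten, so the head completes exactly when [M_2]
    becomes free for the tail. *)
Lemma earliest_from_ge_b (M : R) s t1 t2 sigma : uniq s -> t2 <= M ->
  (forall j, j \in s ->
    completion2 b (earliest_from a b t1 t2 s sigma) j <= M) ->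
  t2 + len b s <= M.
Proof.
elim: s t1 t2 sigma => [|j s IH] t1 t2 sigma /=.
  by rewrite len_nil addr0.
case/andP => js us _ bound; rewrite len_cons.
set u := Num.max _ _ in bound.
have t2u : t2 <= u by rewrite le_max lexx orbT.
have : u + b j + len b s <= M.
  apply: (IH (t1 + a j) (u + b j)) => // [|i si]; last first.
    by apply: bound; rewrite inE si orbT.
  have := bound j; rewrite inE eqxx /completion2 earliest_from_notin //= eqxx.
  exact.
lra.
Qed.

(** The critical path that changes machine at [k]: [M_1] runs [s1] and [k], then [M_2] runs [k] and
    [s2]. With [t1 = 0] this is the term of [k] in the formula for the makespan of Johnson's
    schedule. *)
Lemma earliest_from_ge_ab (M : R) s1 k s2 t1 t2 sigma :
  let s := s1 ++ k :: s2 in uniq s ->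
  (forall j, j \in s ->
    completion2 b (earliest_from a b t1 t2 s sigma) j <= M) ->
  t1 + len a s1 + a k + b k + len b s2 <= M.
Proof.
elim: s1 t1 t2 sigma => [|j s1 IH] t1 t2 sigma /= /andP[js us] bound.
  set u := Num.max _ _ in bound.
  have t1u : t1 + a k <= u by rewrite le_max lexx.
  rewrite len_nil; suff : u + b k + len b s2 <= M by lra.
  apply: (earliest_from_ge_b (t1 := t1 + a k)) => // [|i si]; last first.
    by apply: bound; rewrite inE si orbT.
  have := bound k; rewrite inE eqxx /completion2 earliest_from_notin //= eqxx.
  exact.
rewrite len_cons addrA; apply: IH => // i si; apply: bound.
by rewrite inE si orbT.
Qed.

End Schedules.

(** * Invariants of the two loops *)

Section RunOptimal.
Variables (R : realFieldType) (J : finType) (a b : J -> R).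
Variables (amax beta Omega : R) (pi0 pi1 pi2 : seq J).
Hypotheses (a_ge0 : forall j, 0 <= a j) (b_ge0 : forall j, 0 <= b j).
Hypotheses (amax_gt0 : 0 < amax) (le_amax : forall j, a j <= amax).
Hypotheses (half_amax : amax / 2 <= beta) (le_beta : forall j, b j <= beta).
Hypothesis capacity : 7 / 2 * amax + beta <= Omega.
Hypothesis perm_pi : perm_eq (pi0 ++ pi1 ++ pi2) (enum J).
Hypothesis pi0P : forall j, j \in pi0 -> a j <= b j /\ a j <= amax / 2.
Hypothesis pi1P : forall j, j \in pi1 -> a j <= b j /\ amax / 2 <= a j.
Hypothesis pi2P : forall j, j \in pi2 -> b j <= a j.
Hypothesis permutation_feasible : forall s1 j s2,
  pi0 ++ pi1 ++ pi2 = s1 ++ j :: s2 -> a j <= surplus a b s1.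
Hypothesis balanced : surplus a b (enum J) = 0.

Implicit Types st : state R J.

Definition taken st : seq J :=
  take (idx0 st) pi0 ++ take (idx1 st) pi1 ++ take (idx2 st) pi2.

(** The last bound leaves [amax] below the capacity, which is what the storage estimate asks for. *)
Definition good_position sigma (s : seq J) j : Prop :=
  [/\ start1 sigma j = len a s, start2 sigma j = len b s,
      a j <= surplus a b s & surplus a b s + b j <= 5 / 2 * amax + beta].

(** The bound on the surplus leaves room for a job of [pi2], where [b j <= amax], in
    [good_position]. *)
Definition inv st : Prop :=
  [/\ perm_eq (built st) (taken st),
      forall s1 j s2, built st = s1 ++ j :: s2 -> good_position (sched st) s1 j
    & surplus a b (built st) <= 3 / 2 * amax + beta].

Lemma uniq_taken st : uniq (taken st).
Proof.
apply: (subseq_uniq (s2 := pi0 ++ pi1 ++ pi2)).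
  by rewrite /taken !cat_subseq // take_subseq.
by rewrite (perm_uniq perm_pi) enum_uniq.
Qed.

Lemma inv_uniq st : inv st -> uniq (built st).
Proof. by case=> p _ _; rewrite (perm_uniq p) uniq_taken. Qed.

Lemma inv_size st : inv st -> (size (built st) <= #|J|)%N.
Proof.
move/inv_uniq => u; rewrite cardE; apply: uniq_leq_size => // j _.
by rewrite mem_enum.
Qed.

Lemma inv_place st j i0 i1 i2 :
  let r := surplus a b (built st) in
  let st' := State (rcons (built st) j) i0 i1 i2 (place a b st j) in
  inv st -> perm_eq (j :: taken st) (taken st') ->
  a j <= r -> r + b j <= 5 / 2 * amax + beta ->
  r + (b j - a j) <= 3 / 2 * amax + beta -> inv st'.
Proof.
move=> r st' [p laid rM] p' ajr rb rba.
have p_built : perm_eq (built st') (taken st').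
  apply: perm_trans p'; rewrite /st' /= perm_rcons perm_cons.
  exact: p.
have : uniq (built st') by rewrite (perm_uniq p_built) uniq_taken.
rewrite /st' /= rcons_uniq => /andP[jn _].
split; [exact: p_built| |by rewrite /= surplus_rcons].
rewrite /st' /= => s1 i s2 e'.
have [[-> ->]|[s2' e]] := cat_rcons_split e'.
  by split; rewrite //= eqxx.
(* As [j] is new, setting its start times leaves those of earlier jobs unchanged. *)
have ij : i != j.
  by apply: contraNN jn => /eqP<-; rewrite e mem_cat inE eqxx orbT.
by case: (laid _ _ _ e) => ? ? ? ?; split; rewrite //= (negbTE ij).
Qed.

Lemma surplus_split st :
  surplus a b (take (idx0 st) pi0) + surplus a b (take (idx1 st) pi1) +
  surplus a b (take (idx2 st) pi2) + surplus a b (drop (idx0 st) pi0) +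
  surplus a b (drop (idx1 st) pi1) + surplus a b (drop (idx2 st) pi2) = 0.
Proof.
rewrite -balanced -(perm_surplus _ _ perm_pi).
rewrite !surplus_cat -[in RHS](cat_take_drop (idx0 st) pi0).
rewrite -[in RHS](cat_take_drop (idx1 st) pi1).
rewrite -[in RHS](cat_take_drop (idx2 st) pi2) !surplus_cat; lra.
Qed.

Lemma surplus_drop0_ge0 k : 0 <= surplus a b (drop k pi0).
Proof. by apply: surplus_ge0 => j /mem_drop /pi0P[]. Qed.

Lemma surplus_drop1_ge0 k : 0 <= surplus a b (drop k pi1).
Proof. by apply: surplus_ge0 => j /mem_drop /pi1P[]. Qed.

(* Were [pi2] exhausted, the jobs still to come would all have nonnegative
   Delta although the total surplus is 0. *)
Lemma pi2_available st : inv st -> 0 < surplus a b (built st) ->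
  exists j, onth pi2 (idx2 st) = Some j.
Proof.
case=> p _ _; rewrite (perm_surplus _ _ p) /taken !surplus_cat => r_gt0.
apply: ex_onth; rewrite ltnNge; apply/negP => ge2; have := surplus_split st.
rewrite (drop_oversize ge2) [surplus a b [::]]/surplus !len_nil.
have := surplus_drop0_ge0 (idx0 st); have := surplus_drop1_ge0 (idx1 st).
lra.
Qed.

(** Before the first job of [pi2], the precedence constraint is inherited from the permutation.
    Afterwards [amax / 2 <= r] suffices for jobs of [pi0], and [r + mu], which these jobs leave
    unchanged, foretells the surplus at the end of [pi0]. *)
Definition inv1 st : Prop :=
  let r := surplus a b (built st) in
  [/\ inv st, idx1 st = 0%N &
    idx2 st = 0%N /\ built st = take (idx0 st) pi0 \/
    amax / 2 <= r /\ amax <= r + mu a b pi0 (idx0 st)].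

Lemma body1_step st : inv1 st -> (idx0 st < size pi0)%N ->
  exists st', [/\ body1 a b amax pi0 pi2 st = Some st', inv1 st' &
    (#|J| - size (built st') < #|J| - size (built st))%N].
Proof.
have amax_pos := amax_gt0; have beta_ge := half_amax.
case=> inv_st i1 phase /ex_onth[j0 ej0].
suff [st' [-> inv1_st' e]] : exists st',
    [/\ body1 a b amax pi0 pi2 st = Some st', inv1 st' &
      size (built st') = (size (built st)).+1].
  exists st'; split => //; rewrite e; case: inv1_st' => /inv_size.
  by rewrite e => *; lia.
have j0pi0 : j0 \in pi0 by apply/onthP; exists (idx0 st).
have [ab0 aj0] := pi0P j0pi0.
have mu0 : mu a b pi0 (idx0 st) = b j0 - a j0 + mu a b pi0 (idx0 st).+1.
  by rewrite /mu (drop_onth ej0) big_cons.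
have mu_ge0 : 0 <= mu a b pi0 (idx0 st).+1.
  by rewrite mu_surplus surplus_drop0_ge0.
have bj0 := le_beta j0; have a0 := a_ge0 j0.
set r := surplus a b (built st) in phase *.
have [_ _ rM] := inv_st; rewrite -/r in rM.
have take0_ok : r < 2 * amax -> r + (b j0 - a j0) <= 3 / 2 * amax + beta ->
    exists st', [/\ Defs.take0 a b pi0 st = Some st', inv1 st' &
      size (built st') = (size (built st)).+1].
  move=> r_lt r_le; rewrite /Defs.take0 ej0 /=; eexists; split; first by [].
    have aj0_r : a j0 <= r.
      case: phase => [[_ e]|[]]; last by lra.
      rewrite /r e; apply: (permutation_feasible
        (s2 := drop (idx0 st).+1 pi0 ++ pi1 ++ pi2)).
      by rewrite -cat_cons -(drop_onth ej0) [RHS]catA cat_take_drop.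
    split => //=.
      apply: inv_place => //; rewrite -/r; [|lra..].
      rewrite /taken /= (take_onth ej0) -cats1 -!catA perm_sym.
      by rewrite perm_catCA.
    rewrite surplus_rcons -/r (take_onth ej0); case: phase => [[-> ->]|[? ?]].
      by left.
    by right; split; lra.
  by rewrite /= size_rcons.
(* Below [3 / 2 * amax], a job of [pi0] adds at most [beta]. *)
rewrite /body1 -/r; case: ifPn => [r_lt|]; first by apply: take0_ok; lra.
rewrite -leNgt => r_ge.
have [|j2 ej2] := pi2_available inv_st; first by rewrite -/r; lra.
have j2pi2 : j2 \in pi2 by apply/onthP; exists (idx2 st).
have ba2 := pi2P j2pi2; have a2 := le_amax j2; have b2 := b_ge0 j2.
rewrite ej2 /= /Delta; case: ifPn => [/andP[r_lt test]|test].
  (* As [j2] costs at most [amax], the test gives [r + mu < 2 * amax]; the gain of [j0] is at most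
     [mu], and [amax / 2 <= beta] concludes. *)
  apply: take0_ok => //; lra.
rewrite /take2 ej2 /=; eexists; split; first by [].
  split => //=.
    apply: inv_place => //; rewrite -/r; [|lra..].
    rewrite /taken /= (take_onth ej2) -rcons_cat -rcons_cat perm_sym.
    by rewrite perm_rcons.
  rewrite surplus_rcons -/r; right; split; first by lra.
  (* Either [2 * amax <= r], and [j2] costs at most [amax] while [mu] is nonnegative, or the other
     comparison fails, which is the claim. *)
  move: test; rewrite negb_and -!leNgt => /orP[]; lra.
by rewrite /= size_rcons.
Qed.

(** Three reasons why the next job may start on [M_2]: the sequence is still a prefix of the
    permutation, the surplus covers any job, or only a suffix of the permutation remains. *)
Definition inv2 st : Prop :=
  [/\ inv st, (size pi0 <= idx0 st)%N &
    [\/ idx2 st = 0%N /\ built st = pi0 ++ take (idx1 st) pi1,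
        amax <= surplus a b (built st) | (size pi1 <= idx1 st)%N]].

(** Once [pi0] is exhausted [mu] vanishes, so [amax <= r + mu] becomes [amax <= r]. *)
Lemma inv1_inv2 st : inv1 st -> ~~ (idx0 st < size pi0)%N -> inv2 st.
Proof.
case=> inv_st i1 phase; rewrite -leqNgt => ge0; split => //.
case: phase => [[-> ->]|[_]].
  by constructor 1; rewrite i1 take0 cats0 take_oversize.
by rewrite mu_surplus drop_oversize // /surplus !len_nil subrr addr0; constructor 2.
Qed.

Lemma body2_step st : inv2 st -> (size (built st) < #|J|)%N ->
  exists st', [/\ body2 a b amax pi1 pi2 st = Some st', inv2 st' &
    (#|J| - size (built st') < #|J| - size (built st))%N].
Proof.
have amax_pos := amax_gt0; have beta_ge := half_amax.
case=> inv_st i0 phase lt_size.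
suff [st' [-> inv2_st' e]] : exists st',
    [/\ body2 a b amax pi1 pi2 st = Some st', inv2 st' &
      size (built st') = (size (built st)).+1].
  by exists st'; split => //; rewrite e; lia.
set r := surplus a b (built st) in phase *.
have [p _ rM] := inv_st; rewrite -/r in rM.
rewrite /body2 -/r; case: ifPn => [/andP[r_lt lt1]|test].
  have [j1 ej1] := ex_onth lt1.
  have j1pi1 : j1 \in pi1 by apply/onthP; exists (idx1 st).
  have [ab1 aj1] := pi1P j1pi1; have := le_amax j1; have := le_beta j1.
  move=> bj1 aj1_le.
  rewrite /take1 ej1 /=; eexists; split; [by []| |by rewrite /= size_rcons].
  have aj1_r : a j1 <= r.
    case: phase => [[_ e]||]; [|lra|by rewrite leqNgt lt1].
    rewrite /r e; apply: (permutation_feasible (s2 := drop (idx1 st).+1 pi1 ++ pi2)).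
    by rewrite -cat_cons -(drop_onth ej1) -catA; congr cat; rewrite catA cat_take_drop.
  split => //=.
    (* From [r < 2 * amax] and [amax / 2 <= a j1], the new surplus is at most
       [3 / 2 * amax + beta]. *)
    apply: inv_place => //; rewrite -/r; [|lra..].
    rewrite /taken /= (take_onth ej1) -cats1 -!catA perm_sym.
    by rewrite catA perm_catCA -catA.
  rewrite surplus_rcons -/r (take_onth ej1) -rcons_cat.
  case: phase => [[-> ->]||]; [by constructor 1| |by rewrite leqNgt lt1].
  by move=> r_ge; constructor 2; lra.
have take2_ok j2 : onth pi2 (idx2 st) = Some j2 -> a j2 <= r ->
    amax <= r + (b j2 - a j2) \/ (size pi1 <= idx1 st)%N ->
    exists st', [/\ take2 a b pi2 st = Some st', inv2 st' &
      size (built st') = (size (built st)).+1].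
  move=> ej2 aj2_r next.
  have j2pi2 : j2 \in pi2 by apply/onthP; exists (idx2 st).
  have ba2 := pi2P j2pi2; have a2 := le_amax j2; have b2 := b_ge0 j2.
  rewrite /take2 ej2 /=; eexists; split; [by []| |by rewrite /= size_rcons].
  split => //=.
    apply: inv_place => //; rewrite -/r; [|lra..].
    rewrite /taken /= (take_onth ej2) -rcons_cat -rcons_cat perm_sym.
    by rewrite perm_rcons.
  rewrite surplus_rcons -/r.
  by case: next => ?; [constructor 2|constructor 3].
have [ge1|lt1] := leqP (size pi1) (idx1 st).
  (* The jobs placed are those of a prefix of the permutation, and the surplus does not depend on
     their order. *)
  have et : taken st = pi0 ++ pi1 ++ take (idx2 st) pi2.
    by rewrite /taken (take_oversize i0) (take_oversize ge1).
  have /ex_onth[j2 ej2] : (idx2 st < size pi2)%N.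
    rewrite ltnNge; apply/negP => ge2; move: lt_size.
    by rewrite (perm_size p) et (take_oversize ge2) (perm_size perm_pi) -cardE ltnn.
  apply: (take2_ok j2) => //; last by right.
  rewrite /r (perm_surplus _ _ p) et.
  apply: (permutation_feasible (s2 := drop (idx2 st).+1 pi2)).
  by rewrite -(drop_onth ej2) -!catA cat_take_drop.
(* A job of [pi1] remains, so [2 * amax <= r], and a job of [pi2] leaves at least [amax]. *)
move: test; rewrite lt1 andbT -leNgt => r_ge.
have [|j2 ej2] := pi2_available inv_st; first by rewrite -/r; lra.
have a2 := le_amax j2; have b2 := b_ge0 j2.
by apply: (take2_ok j2) => //; [lra|left; lra].
Qed.

Lemma run_optimal : exists sigma,
  run a b amax pi0 pi1 pi2 = Some sigma /\ optimal a b Omega sigma.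
Proof.
have amax_pos := amax_gt0; have beta_ge := half_amax; have cap := capacity.
have inv1_init : inv1 (State [::] 0 0 0 (schedule0 R J)).
  split => //; last by left; rewrite take0.
  split; rewrite /= ?/taken /= ?take0 //; first by case.
  rewrite /surplus !len_nil; lra.
rewrite /run.
(* The measure is the number of jobs not yet placed, hence at most the fuel. *)
have [|st1 [-> inv1_st1 done1]] :=
  while_ind_measure body1_step (fuel := #|J|) inv1_init; first exact: leq_subr.
have [|st2 [/= -> [inv_st2 _ _]]] :=
  while_ind_measure body2_step (fuel := #|J|) (inv1_inv2 inv1_st1 done1).
  exact: leq_subr.
rewrite -leqNgt => full; exists (sched st2); split => //.
have u := inv_uniq inv_st2; have [_ good _] := inv_st2.
(* As many distinct jobs as [J] has elements are all the jobs. *)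
have [||_ e] := uniq_min_size (s2 := enum J) u.
- by move=> j _; rewrite mem_enum.
- by rewrite -cardE.
have perm_built : perm_eq (built st2) (enum J).
  by apply: uniq_perm => //; rewrite enum_uniq.
apply: (sequential_optimal a_ge0 b_ge0 (ltW amax_pos) le_amax perm_built).
- by move=> s1 j s2 es; case: (good _ _ _ es).
- by move=> s1 j s2 es; case: (good _ _ _ es).
- lra.
- by move=> s1 j s2 es; case: (good _ _ _ es) => *; lra.
Qed.

End RunOptimal.

(** * The extended job set *)

Lemma ceil_parts (R : archiRealFieldType) (x m : R) :
  let k := `|Num.ceil (x / m)|%N in
  0 <= x -> 0 < m -> x / k%:R *+ k = x /\ x / k%:R <= m.
Proof.
move=> k; rewrite le_eqVlt => /orP[/eqP <-|x_gt0] m_gt0.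
  (* For [x = 0] there is nothing to divide: [0 / k] is 0 whatever [k] is. *)
  by rewrite !mul0r mul0rn; split=> //; apply: ltW.
have xm : x / m <= k%:R.
  have xm_ge0 : 0 <= x / m by rewrite divr_ge0 // ltW.
  apply: le_trans (ceil_ge _) _.
  by rewrite -[k%:R]/(k%:Z%:~R) ler_int ler_norm.
have k_gt0 : 0 < k%:R :> R by apply: lt_le_trans xm; rewrite divr_gt0.
split; first by rewrite -mulr_natr divfK // gt_eqF.
by rewrite ler_pdivrMr // mulrC -ler_pdivrMr.
Qed.

Section Extension.
Variables (R : archiRealFieldType) (N : finType) (a b : N -> R).
Hypotheses (a_ge0 : forall j, 0 <= a j) (b_ge0 : forall j, 0 <= b j).
Hypotheses (amax_gt0 : 0 < max_time a) (bmax_gt0 : 0 < max_time b).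
Variable sJ : seq N.
Hypothesis sJ_johnson : johnson_order a b sJ.

Local Notation C := (Cmax_johnson a b sJ).
Local Notation J := (ext_job a b sJ).
Local Notation ea := (@ext_a R N a b sJ).
Local Notation eb := (@ext_b R N a b sJ).
Local Notation jX := (@jobX R N a b sJ).
Local Notation jN := (@jobN R N a b sJ).
Local Notation jY := (@jobY R N a b sJ).

Lemma le_max_time (p : N -> R) i : p i <= max_time p.
Proof. exact: le_bigmax. Qed.

Lemma johnson_perm : perm_eq sJ (enum N).
Proof.
have [s1 [s2 [-> p1 p2 _ _]]] := sJ_johnson.
apply: uniq_perm; rewrite ?enum_uniq //.
  rewrite cat_uniq (perm_uniq p1) (perm_uniq p2) !enum_uniq andbT /=.
  apply/hasPn => i; rewrite (perm_mem p1) (perm_mem p2) !mem_enum !inE.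
  by rewrite -leNgt.
move=> i; rewrite mem_cat (perm_mem p1) (perm_mem p2) !mem_enum !inE.
by case: ltP.
Qed.

Lemma johnson_uniq : uniq sJ.
Proof. by rewrite (perm_uniq johnson_perm) enum_uniq. Qed.

Lemma Cmax_johnson_ge t1 k t2 : sJ = t1 ++ k :: t2 ->
  len a t1 + a k + b k + len b t2 <= C.
Proof.
move=> e; have u := johnson_uniq; rewrite e in u.
rewrite -[len a t1]add0r.
apply: (earliest_from_ge_ab (t2 := 0) (sigma := schedule0 R N) u) => j _.
rewrite /Cmax_johnson /earliest_schedule e; exact: le_bigmax.
Qed.

Lemma idle2_ge0 : 0 <= idle2 a b sJ.
Proof.
rewrite /idle2 subr_ge0 -big_enum /= -(perm_big _ johnson_perm) /=.
rewrite -[leLHS]add0r.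
apply: (earliest_from_ge_b (t1 := 0) (sigma := schedule0 R N) johnson_uniq).
  exact: bigmax_ge_id.
move=> j _; exact: le_bigmax.
Qed.

(** The critical path through the last job contains the whole load of [M_1]. *)
Lemma idle1_ge0 : 0 <= idle1 a b sJ.
Proof.
rewrite /idle1 subr_ge0 -big_enum /= -(perm_big _ johnson_perm) /=.
have last_case (s : seq N) : s = [::] \/ exists t k, s = rcons t k.
  by case/lastP: s => [|t k]; [left|right; exists t, k].
case: (last_case sJ) => [e|[t [k e]]].
  by rewrite [X in \sum_(_ <- X) _]e big_nil; apply: bigmax_ge_id.
have := Cmax_johnson_ge (t1 := t) (k := k) (t2 := [::]); rewrite cats1 => /(_ e).
have -> : \sum_(i <- sJ) a i = len a t + a k by rewrite e -len_rcons.
rewrite len_nil; have := b_ge0 k; lra.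
Qed.

Lemma ext_a_ge0 j : 0 <= ea j.
Proof.
case: j => [[//|i]|i] /=; first exact: a_ge0.
by rewrite divr_ge0 ?ler0n // idle1_ge0.
Qed.

Lemma ext_b_ge0 j : 0 <= eb j.
Proof.
case: j => [[i|i]|//] /=; last exact: b_ge0.
by rewrite divr_ge0 ?ler0n // idle2_ge0.
Qed.

Lemma ext_a_le j : ea j <= max_time a.
Proof.
case: j => [[i|i]|i] /=; [exact: ltW|exact: le_max_time|].
by have [] := ceil_parts idle1_ge0 amax_gt0.
Qed.

Lemma ext_b_le j : eb j <= max_time b.
Proof.
case: j => [[i|i]|i] /=; [|exact: le_max_time|exact: ltW].
by have [] := ceil_parts idle2_ge0 bmax_gt0.
Qed.

Variables (piJ : seq J) (xs : seq 'I_(Defs.cardX a b sJ)).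
Variable ys : seq 'I_(Defs.cardY a b sJ).
Hypotheses (perm_xs : perm_eq xs (enum 'I_(Defs.cardX a b sJ)))
  (perm_ys : perm_eq ys (enum 'I_(Defs.cardY a b sJ)))
  (piJE : piJ = map jX xs ++ map jN sJ ++ map jY ys).

Lemma ext_perm : perm_eq piJ (enum J).
Proof.
have mem_piJ j : j \in piJ.
  rewrite piJE !mem_cat; case: j => [[i|i]|i]; apply/or3P.
  - by constructor 1; apply: map_f; rewrite (perm_mem perm_xs) mem_enum.
  - by constructor 2; apply: map_f; rewrite (perm_mem johnson_perm) mem_enum.
  - by constructor 3; apply: map_f; rewrite (perm_mem perm_ys) mem_enum.
apply: uniq_perm; rewrite ?enum_uniq //.
  rewrite piJE !cat_uniq !map_inj_uniq; last by move=> ? ? [].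
  - rewrite (perm_uniq perm_xs) (perm_uniq perm_ys) johnson_uniq !enum_uniq /= andbT.
    apply/andP; split; apply/hasPn => j.
      by rewrite mem_cat => /orP[] /mapP[i _ ->]; apply/mapP => -[].
    by move=> /mapP[i _ ->]; apply/mapP => -[].
  - by move=> ? ? [].
  - by move=> ? ? [].
by move=> j; rewrite mem_enum mem_piJ.
Qed.

(** [Y] and [X] add exactly the idle times, which bring the load of each machine to [C]. *)
Lemma ext_balanced : surplus ea eb (enum J) = 0.
Proof.
rewrite -(perm_surplus _ _ ext_perm) piJE /surplus !len_cat /len !big_map /=.
rewrite !big1_eq !(perm_big _ perm_xs) !(perm_big _ perm_ys) /=.
rewrite !(perm_big _ johnson_perm) /= !big_enum /= !sumr_const !card_ord.
have [-> _] := ceil_parts idle1_ge0 amax_gt0.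
have [-> _] := ceil_parts idle2_ge0 bmax_gt0.
rewrite /idle1 /idle2; lra.
Qed.

(* The idle time of [M_2] put in front by [X] is what lets every job of [N]
   start on [M_2] without delay. *)
Lemma ext_order_feasible s1 j s2 : piJ = s1 ++ j :: s2 -> ea j <= surplus ea eb s1.
Proof.
rewrite piJE => e; have [[r ex]|[r -> exr]] := cat_eq_split e.
  have [t1 [x [t2 [_ -> -> _]]]] := map_eq_split ex.
  by apply: surplus_ge0 => ? /mapP[i _ ->]; apply: ext_b_ge0.
have [[r' en]|[r' er ery]] := cat_eq_split exr.
  have [t1 [k [t2 [eJ -> -> _]]]] := map_eq_split en.
  rewrite /surplus !len_cat /len !big_map /= big1_eq (perm_big _ perm_xs) /=.
  rewrite big_enum /= sumr_const card_ord.
  (* The surplus before [k] is [C] minus the load of [M_2] from [k] on and that of [M_1] before [k];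
     the critical path through [k] makes it at least [a k]. *)
  have [-> _] := ceil_parts idle2_ge0 bmax_gt0.
  have := Cmax_johnson_ge eJ; have := perm_len b johnson_perm.
  rewrite eJ len_cat len_cons /idle2 {3}/len big_enum /= /len => <-; lra.
(* For a job of [Y], the total surplus is 0 and the jobs after it only lower the surplus, so it was
   at least the job's length before. *)
have := ext_balanced; rewrite -(perm_surplus _ _ ext_perm) piJE exr er.
rewrite !surplus_cat -cat1s surplus_cat.
have [t1 [y [t2 [_ -> -> ->]]]] := map_eq_split ery.
have -> : surplus ea eb [:: jY y] = - ea (jY y).
  by rewrite /surplus !len_cons !len_nil /= !addr0 add0r.
have : surplus ea eb (map jY t2) <= 0.
  by rewrite subr_le0; apply: le_len => ? /mapP[i _ ->]; apply: ext_a_ge0.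
lra.
Qed.

(** Johnson's order sorts [L_1] by [a], so its small jobs precede its large ones. *)
Lemma filter_ext_order :
  [seq j <- piJ | inL0 j] ++ [seq j <- piJ | inL1 j] ++ [seq j <- piJ | inL2 j]
    = piJ.
Proof.
have [s1 [s2 [es p1 p2 sort1 _]]] := sJ_johnson.
have in1 i : i \in s1 -> a i < b i by rewrite (perm_mem p1) mem_enum.
have in2 i : i \in s2 -> b i <= a i by rewrite (perm_mem p2) mem_enum.
have mapJ (T : Type) (f : N -> T) : map f sJ = map f s1 ++ map f s2.
  by rewrite es map_cat.
pose L0 := @inL0 R N a b sJ; pose L1 := @inL1 R N a b sJ; pose L2 := @inL2 R N a b sJ.
pose small i := a i <= max_time a / 2.
have filter_map_eq (T : eqType) (f : T -> J) (p : pred J) (q : pred T) s :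
    {in s, forall i, p (f i) = q i} -> filter p (map f s) = map f (filter q s).
  by move=> pq; rewrite filter_map; congr map; apply: eq_in_filter.
have filter_piJ p : filter p piJ = filter p (map jX xs) ++
    (filter p (map jN s1) ++ filter p (map jN s2)) ++ filter p (map jY ys).
  by rewrite piJE mapJ !filter_cat.
have -> : filter L0 piJ = map jX xs ++ map jN (filter small s1).
  rewrite filter_piJ (filter_map_eq _ jX _ predT) // (filter_map_eq _ jY _ pred0) //.
  rewrite (filter_map_eq _ jN _ small s1) => [|i /in1 /= ->] //.
  rewrite (filter_map_eq _ jN _ pred0 s2) => [|i /in2 /=]; last first.
    by rewrite leNgt => /negbTE->.
  by rewrite filter_predT !filter_pred0 !cats0.
have -> : filter L1 piJ = map jN (filter (predC small) s1).
  rewrite filter_piJ (filter_map_eq _ jX _ pred0) // (filter_map_eq _ jY _ pred0) //.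
  rewrite (filter_map_eq _ jN _ (predC small) s1) => [|i /in1 /= ->]; last first.
    by rewrite /= ltNge.
  rewrite (filter_map_eq _ jN _ pred0 s2) => [|i /in2 /=]; last first.
    by rewrite leNgt => /negbTE->.
  by rewrite !filter_pred0 !cats0.
have -> : filter L2 piJ = map jN s2 ++ map jY ys.
  rewrite filter_piJ (filter_map_eq _ jX _ pred0) // (filter_map_eq _ jY _ predT) //.
  rewrite (filter_map_eq _ jN _ pred0 s1) => [|i /in1 /=]; last first.
    by rewrite ltNge => /negbTE.
  rewrite (filter_map_eq _ jN _ predT s2) => [|i /in2 //].
  by rewrite !filter_predT !filter_pred0.
rewrite piJE mapJ -!catA; congr cat; rewrite catA -map_cat.
by rewrite (sorted_filter_cat _ sort1).
Qed.

End Extension.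

(** * The algorithm on the extended job set *)

Theorem theorem1 (R : archiRealFieldType) (n : nat) (a b : 'I_n -> R)
    (Omega : R)
    (a_ge0 : forall j, 0 <= a j) (b_ge0 : forall j, 0 <= b j)
    (amax_gt0 : 0 < max_time a) (bmax_gt0 : 0 < max_time b)
    (capacity : 7 / 2 * max_time a + Num.max (max_time a / 2) (max_time b)
                  <= Omega)
    (sJ : seq 'I_n) (sJ_johnson : johnson_order a b sJ)
    (piJ : seq (ext_job a b sJ)) (piJ_order : ext_order piJ) :
  exists sigma : schedule R (ext_job a b sJ),
    algorithm1 piJ = Some sigma /\
    optimal (@ext_a R 'I_n a b sJ) (@ext_b R 'I_n a b sJ) Omega sigma.
Proof.
have [xs [ys [perm_xs perm_ys piJE]]] := piJ_order.
have piE := filter_ext_order sJ_johnson piJE.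
have ea_ge0 := ext_a_ge0 a_ge0 b_ge0 sJ_johnson.
have eb_ge0 := ext_b_ge0 b_ge0 sJ_johnson.
(* Here [capacity] fixes [beta] as the maximum of [amax / 2] and [bmax]. *)
apply: (run_optimal _ _ amax_gt0 _ _ _ capacity).
- exact: ea_ge0.
- exact: eb_ge0.
- exact: ext_a_le.
- by rewrite le_max lexx.
- by move=> j; rewrite le_max ext_b_le ?orbT.
- by rewrite piE; apply: ext_perm perm_xs perm_ys piJE.
- move=> j; rewrite mem_filter => /andP[+ _].
  case: j => [[i _|i]|//] /=; last by case/andP => /ltW.
  by split; [exact: (eb_ge0 (inl (inl i)))|rewrite divr_ge0 // ltW].
- move=> j; rewrite mem_filter => /andP[+ _].
  by case: j => [[//|i]|//] /= /andP[/ltW ? /ltW].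
- move=> j; rewrite mem_filter => /andP[+ _].
  by case: j => [[//|i]|i] //= _; apply: (ea_ge0 (inr i)).
- rewrite piE; exact: ext_order_feasible perm_xs perm_ys piJE.
- exact: ext_balanced perm_xs perm_ys piJE.
Qed.
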